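(* Let $\mathcal C,\mathcal M,\mathcal N$ be categories and let $I:\mathcal M\to\mathcal C$, $M:\mathcal C\to\mathcal M$, $N:\mathcal C\to\mathcal N$, $J:\mathcal N\to\mathcal C$ be functors with adjunctions $N\dashv J$ (with unit $\theta:1_{\mathcal C}\to JN$) and $I\dashv M$ (with counit $\psi:IM\to 1_{\mathcal C}$). Consider the following conditions: (i) $(Nx,\theta_x\circ\psi_x)$ is an initial object in $IMx\downarrow J$ for each object $x$ of $\mathcal C$; (ii) $N\psi_x$ is an isomorphism for each object $x$ of $\mathcal C$; (iii) $(Mx,\theta_x\circ\psi_x)$ is a final object in $I\downarrow JNx$ for each object $x$ of $\mathcal C$; (iv) $M\theta_x$ is an isomorphism for each object $x$ of $\mathcal C$. Then (i) $\Leftrightarrow$ (ii) and (iii) $\Leftrightarrow$ (iv). If these conditions (i)--(iv) are satisfied and $I$ and $J$ are both full and faithful, then the composite adjunction $NI\dashv MJ$ is an adjoint equivalence. On the other hand, if $NI\dashv MJ$ is an adjoint equivalence, then all four conditions (i)--(iv) are equivalent; moreover, $I$ and $J$ are then both full and faithful whenever one of these four conditions holds.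
   Context: An adjunction is called an adjoint equivalence if both its unit and its counit are natural isomorphisms. For a functor $G:\mathcal D\to\mathcal C$ and an object $c$ of $\mathcal C$: the comma category $c\downarrow G$ has as objects pairs $(y,f)$ with $y\in\mathcal D$ and $f:c\to Gy$ in $\mathcal C$, and a morphism $h:(y,f)\to(z,g)$ is $h:y\to z$ in $\mathcal D$ with $(Gh)\circ f=g$. Dually, $G\downarrow c$ has as objects pairs $(y,f)$ with $f:Gy\to c$, and a morphism $h:(y,f)\to(z,g)$ is $h:y\to z$ in $\mathcal D$ with $g\circ(Gh)=f$. The composite adjunction $NI\dashv MJ$ has unit with components $(M\theta_{Ix})\circ\sigma_x$ ($x\in\mathcal M$) and counit with components $\rho_y\circ(N\psi_{Jy})$ ($y\in\mathcal N$), where $\sigma$ is the unit of $I\dashv M$ and $\rho$ is the counit of $N\dashv J$. *)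

(* Defs.v *)
From Corelib Require Import ssreflect.
From Stdlib Require Import ProofIrrelevance.

Set Implicit Arguments.
Unset Strict Implicit.
Unset Printing Implicit Defensive.

Declare Scope cat_scope.
Delimit Scope cat_scope with cat.

Record Category : Type := MkCategory {
  obj :> Type;
  hom : obj -> obj -> Type;
  idm : forall x : obj, hom x x;
  comp : forall x y z : obj, hom y z -> hom x y -> hom x z;
  comp_idl : forall (x y : obj) (f : hom x y), comp (idm y) f = f;
  comp_idr : forall (x y : obj) (f : hom x y), comp f (idm x) = f;
  compA : forall (w x y z : obj) (h : hom y z) (g : hom x y) (f : hom w x),
    comp h (comp g f) = comp (comp h g) f
}.

Arguments hom {_} _ _.
Arguments idm {_} _.
Arguments comp {_ _ _ _} _ _.
Arguments comp_idl {_ _ _} _.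
Arguments comp_idr {_ _ _} _.
Arguments compA {_ _ _ _ _} _ _ _.

Notation "g ∘ f" := (comp g f) (at level 40, left associativity) : cat_scope.
Open Scope cat_scope.

Definition is_iso (C : Category) (x y : C) (f : hom x y) : Prop :=
  exists g : hom y x, g ∘ f = idm x /\ f ∘ g = idm y.

Definition is_initial (C : Category) (x : C) : Prop :=
  forall y : C, exists f : hom x y, forall g : hom x y, g = f.

Definition is_final (C : Category) (x : C) : Prop :=
  forall y : C, exists f : hom y x, forall g : hom y x, g = f.

Arguments is_initial C x : clear implicits.
Arguments is_final C x : clear implicits.

Record Functor (C D : Category) : Type := MkFunctor {
  fobj :> C -> D;
  fmap : forall x y : C, hom x y -> hom (fobj x) (fobj y);
  fmap_id : forall x : C, fmap (idm x) = idm (fobj x);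
  fmap_comp : forall (x y z : C) (g : hom y z) (f : hom x y),
    fmap (g ∘ f) = fmap g ∘ fmap f
}.

Arguments fmap {_ _} _ {_ _} _.
Arguments fmap_id {_ _} _ _.
Arguments fmap_comp {_ _} _ {_ _ _} _ _.

Definition faithful (C D : Category) (F : Functor C D) : Prop :=
  forall (x y : C) (f g : hom x y), fmap F f = fmap F g -> f = g.

Definition full (C D : Category) (F : Functor C D) : Prop :=
  forall (x y : C) (g : hom (F x) (F y)), exists f : hom x y, fmap F f = g.

Definition idF (C : Category) : Functor C C :=
  @MkFunctor C C (fun x => x) (fun x y f => f)
    (fun x => eq_refl) (fun x y z g f => eq_refl).

Definition compF (A B C : Category) (G : Functor B C) (F : Functor A B) :
  Functor A C.
Proof.
refine (@MkFunctor A C (fun x => G (F x)) (fun x y f => fmap G (fmap F f)) _ _).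
- by move=> x; rewrite !fmap_id.
- by move=> x y z g f; rewrite !fmap_comp.
Defined.

Record NatTrans (C D : Category) (F G : Functor C D) : Type := MkNatTrans {
  component :> forall x : C, hom (F x) (G x);
  naturality : forall (x y : C) (f : hom x y),
    fmap G f ∘ component x = component y ∘ fmap F f
}.

Definition is_natural_iso (C D : Category) (F G : Functor C D)
  (alpha : NatTrans F G) : Prop :=
  forall x : C, is_iso (alpha x).

(* [Adjunction F G] is the data of F ⊣ G. *)
Record Adjunction (C D : Category) (F : Functor C D) (G : Functor D C) : Type :=
  MkAdjunction {
  adj_unit : NatTrans (idF C) (compF G F);
  adj_counit : NatTrans (compF F G) (idF D);
  triangle_l : forall x : C, adj_counit (F x) ∘ fmap F (adj_unit x) = idm (F x);
  triangle_r : forall y : D, fmap G (adj_counit y) ∘ adj_unit (G y) = idm (G y)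
}.

Definition is_adjoint_equivalence (C D : Category)
  (F : Functor C D) (G : Functor D C) (adj : Adjunction F G) : Prop :=
  is_natural_iso (adj_unit adj) /\ is_natural_iso (adj_counit adj).

(* F1 ⊣ G1 and F2 ⊣ G2 compose to F2 F1 ⊣ G1 G2. *)

Definition comp_unit (A B C : Category)
  (F1 : Functor A B) (G1 : Functor B A) (F2 : Functor B C) (G2 : Functor C B)
  (adj2 : Adjunction F2 G2) (adj1 : Adjunction F1 G1) :
  NatTrans (idF A) (compF (compF G1 G2) (compF F2 F1)).
Proof.
refine (@MkNatTrans A A (idF A) (compF (compF G1 G2) (compF F2 F1))
  (fun x => fmap G1 (adj_unit adj2 (F1 x)) ∘ adj_unit adj1 x) _).
move=> x y f /=.
have /= n1 := naturality (adj_unit adj1) f.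
have /= n2 := naturality (adj_unit adj2) (fmap F1 f).
by rewrite compA -fmap_comp n2 fmap_comp -compA n1 compA.
Defined.

Definition comp_counit (A B C : Category)
  (F1 : Functor A B) (G1 : Functor B A) (F2 : Functor B C) (G2 : Functor C B)
  (adj2 : Adjunction F2 G2) (adj1 : Adjunction F1 G1) :
  NatTrans (compF (compF F2 F1) (compF G1 G2)) (idF C).
Proof.
refine (@MkNatTrans C C (compF (compF F2 F1) (compF G1 G2)) (idF C)
  (fun y => adj_counit adj2 y ∘ fmap F2 (adj_counit adj1 (G2 y))) _).
move=> x y f /=.
have /= n1 := naturality (adj_counit adj1) (fmap G2 f).
have /= n2 := naturality (adj_counit adj2) f.
by rewrite compA n2 -compA -fmap_comp n1 fmap_comp compA.
Defined.

Definition comp_adjunction (A B C : Category)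
  (F1 : Functor A B) (G1 : Functor B A) (F2 : Functor B C) (G2 : Functor C B)
  (adj2 : Adjunction F2 G2) (adj1 : Adjunction F1 G1) :
  Adjunction (compF F2 F1) (compF G1 G2).
Proof.
refine (@MkAdjunction A C (compF F2 F1) (compF G1 G2)
  (comp_unit adj2 adj1) (comp_counit adj2 adj1) _ _).
- move=> x /=.
  have /= n := naturality (adj_counit adj1) (adj_unit adj2 (F1 x)).
  rewrite -compA -fmap_comp (fmap_comp F1) compA -n -compA triangle_l comp_idr.
  exact: triangle_l.
- move=> y /=.
  have /= n := naturality (adj_unit adj2) (adj_counit adj1 (G2 y)).
  rewrite compA -fmap_comp (fmap_comp G2) -compA n compA triangle_r comp_idl.
  exact: triangle_r.
Defined.

Lemma sig_ext (T : Type) (P : T -> Prop) (u v : {x : T | P x}) :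
  proj1_sig u = proj1_sig v -> u = v.
Proof. by case: u v => [x Px] [y Py] /= e; apply: subset_eq_compat. Qed.

(* The comma category c ↓ G, with objects (y, f : c → G y). *)

Record under_obj (C D : Category) (c : C) (G : Functor D C) : Type := UnderObj {
  under_dom : D;
  under_arr : hom c (G under_dom)
}.

Arguments UnderObj {C D c G} _ _.

Definition under_hom (C D : Category) (c : C) (G : Functor D C)
  (u v : under_obj c G) : Type :=
  {h : hom (under_dom u) (under_dom v) | fmap G h ∘ under_arr u = under_arr v}.

Definition under_id (C D : Category) (c : C) (G : Functor D C)
  (u : under_obj c G) : under_hom u u.
Proof. by exists (idm (under_dom u)); rewrite fmap_id comp_idl. Defined.

Definition under_comp (C D : Category) (c : C) (G : Functor D C)
  (u v w : under_obj c G) (k : under_hom v w) (h : under_hom u v) :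
  under_hom u w.
Proof.
exists (proj1_sig k ∘ proj1_sig h).
by rewrite fmap_comp -compA (proj2_sig h) (proj2_sig k).
Defined.

Definition under (C D : Category) (c : C) (G : Functor D C) : Category.
Proof.
refine (@MkCategory (under_obj c G) (@under_hom C D c G)
  (@under_id C D c G) (@under_comp C D c G) _ _ _).
- by move=> u v f; apply: sig_ext; apply: comp_idl.
- by move=> u v f; apply: sig_ext; apply: comp_idr.
- by move=> t u v w h g f; apply: sig_ext; apply: compA.
Defined.

(* The comma category G ↓ c, with objects (y, f : G y → c). *)

Record over_obj (C D : Category) (G : Functor D C) (c : C) : Type := OverObj {
  over_dom : D;
  over_arr : hom (G over_dom) c
}.

Arguments OverObj {C D G c} _ _.

Definition over_hom (C D : Category) (G : Functor D C) (c : C)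
  (u v : over_obj G c) : Type :=
  {h : hom (over_dom u) (over_dom v) | over_arr v ∘ fmap G h = over_arr u}.

Definition over_id (C D : Category) (G : Functor D C) (c : C)
  (u : over_obj G c) : over_hom u u.
Proof. by exists (idm (over_dom u)); rewrite fmap_id comp_idr. Defined.

Definition over_comp (C D : Category) (G : Functor D C) (c : C)
  (u v w : over_obj G c) (k : over_hom v w) (h : over_hom u v) :
  over_hom u w.
Proof.
exists (proj1_sig k ∘ proj1_sig h).
by rewrite fmap_comp compA (proj2_sig k) (proj2_sig h).
Defined.

Definition over (C D : Category) (G : Functor D C) (c : C) : Category.
Proof.
refine (@MkCategory (over_obj G c) (@over_hom C D G c)
  (@over_id C D G c) (@over_comp C D G c) _ _ _).
- by move=> u v f; apply: sig_ext; apply: comp_idl.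
- by move=> u v f; apply: sig_ext; apply: comp_idr.
- by move=> t u v w h g f; apply: sig_ext; apply: compA.
Defined.

(* Main.v *)
(** The arrow θ_x ∘ ψ_x corresponds to N ψ_x under N ⊣ J and to M θ_x under
    I ⊣ M, and an object of a comma category of an adjoint is universal exactly
    when the corresponding arrow is invertible.  When N I ⊣ M J is an adjoint
    equivalence and N ψ is invertible, the counit ρ of N ⊣ J is invertible,
    hence so is N θ, hence so is N I M θ (being isomorphic to N θ through N ψ),
    and N I reflects isomorphisms, so M θ is invertible; the converse is this
    argument in the opposite categories. *)

From Corelib Require Import ssreflect.
Require Import Defs.

Set Implicit Arguments.
Unset Strict Implicit.
Unset Printing Implicit Defensive.

Lemma is_iso_comp (C : Category) (x y z : C) (g : hom y z) (f : hom x y) :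
  is_iso g -> is_iso f -> is_iso (g ∘ f).
Proof.
move=> [g' [g'g gg']] [f' [f'f ff']]; exists (f' ∘ g'); split.
- by rewrite -compA (compA g') g'g comp_idl.
- by rewrite -compA (compA f) ff' comp_idl.
Qed.

Lemma is_iso_fmap (C D : Category) (F : Functor C D) (x y : C) (f : hom x y) :
  is_iso f -> is_iso (fmap F f).
Proof.
by move=> [g [gf fg]]; exists (fmap F g); rewrite -!fmap_comp gf fg !fmap_id.
Qed.

Lemma is_iso_cancell (C : Category) (x y z : C) (g : hom y z) (f : hom x y) :
  is_iso g -> is_iso (g ∘ f) -> is_iso f.
Proof.
move=> [g' [g'g gg']] gf_iso; rewrite -(comp_idl f) -g'g -compA.
by apply: is_iso_comp gf_iso; exists g.
Qed.

Lemma is_iso_cancelr (C : Category) (x y z : C) (g : hom y z) (f : hom x y) :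
  is_iso f -> is_iso (g ∘ f) -> is_iso g.
Proof.
move=> [f' [f'f ff']] gf_iso; rewrite -(comp_idr g) -ff' compA.
by apply: is_iso_comp => //; exists f.
Qed.

Lemma is_iso_idm (C : Category) (x : C) : is_iso (idm x).
Proof. by exists (idm x); rewrite comp_idl. Qed.

Lemma is_iso_mono (C : Category) (x y z : C) (m : hom y z) (f g : hom x y) :
  is_iso m -> m ∘ f = m ∘ g -> f = g.
Proof.
by move=> [m' [m'm _]] e; rewrite -(comp_idl f) -m'm -compA e compA m'm comp_idl.
Qed.

(** The arrows of [op C] are those of [C] up to conversion, so an arrow can be read in either
    category without a cast. *)
Definition op (C : Category) : Category :=
  @MkCategory C (fun x y => @hom C y x) (fun x => idm x)
    (fun x y z g f => f ∘ g)
    (fun x y f => comp_idr f) (fun x y f => comp_idl f)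
    (fun w x y z h g f => eq_sym (compA f g h)).

Definition opF (C D : Category) (F : Functor C D) : Functor (op C) (op D) :=
  @MkFunctor (op C) (op D) (fun x => F x) (fun x y f => fmap F f)
    (fun x => fmap_id F x) (fun x y z g f => fmap_comp F f g).

Definition op_unit (C D : Category) (F : Functor C D) (G : Functor D C)
  (adj : Adjunction F G) : NatTrans (idF (op D)) (compF (opF F) (opF G)) :=
  @MkNatTrans (op D) (op D) (idF (op D)) (compF (opF F) (opF G))
    (fun y => adj_counit adj y)
    (fun x y f => eq_sym (naturality (adj_counit adj) f)).

Definition op_counit (C D : Category) (F : Functor C D) (G : Functor D C)
  (adj : Adjunction F G) : NatTrans (compF (opF G) (opF F)) (idF (op C)) :=
  @MkNatTrans (op C) (op C) (compF (opF G) (opF F)) (idF (op C))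
    (fun x => adj_unit adj x)
    (fun x y f => eq_sym (naturality (adj_unit adj) f)).

Definition op_adjunction (C D : Category) (F : Functor C D) (G : Functor D C)
  (adj : Adjunction F G) : Adjunction (opF G) (opF F) :=
  @MkAdjunction (op D) (op C) (opF G) (opF F) (op_unit adj) (op_counit adj)
    (fun y => triangle_r adj y) (fun x => triangle_l adj x).

Lemma is_iso_op (C : Category) (x y : C) (f : hom x y) :
  is_iso f <-> @is_iso (op C) y x f.
Proof. by split=> - [g [gf fg]]; exists g; split. Qed.

(** Arrows into [(y, f)] in the first comma category and arrows out of it in the second have
    convertible types, so witness and uniqueness carry over unchanged. *)
Lemma is_final_over_op (C D : Category) (G : Functor D C) (c : C) (y : D)
  (f : hom (G y) c) :
  is_final (over G c) (OverObj y f) <->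
  is_initial (@under (op C) (op D) c (opF G))
    (@UnderObj (op C) (op D) c (opF G) y f).
Proof.
split=> H [z k].
- by have [h hP] := H (@OverObj C D G c z k); exists h.
- by have [h hP] := H (@UnderObj (op C) (op D) c (opF G) z k); exists h.
Qed.

Lemma transpose_eq (C D : Category) (F : Functor C D) (G : Functor D C)
  (adj : Adjunction F G) (c : C) (y : D) (h : hom (F c) y) :
  adj_counit adj y ∘ fmap F (fmap G h ∘ adj_unit adj c) = h.
Proof.
have /= n := naturality (adj_counit adj) h.
by rewrite fmap_comp compA -n -compA triangle_l comp_idr.
Qed.

Lemma transpose_eqV (C D : Category) (F : Functor C D) (G : Functor D C)
  (adj : Adjunction F G) (c : C) (y : D) (k : hom c (G y)) :
  fmap G (adj_counit adj y ∘ fmap F k) ∘ adj_unit adj c = k.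
Proof.
have /= n := naturality (adj_unit adj) k.
by rewrite fmap_comp -compA n compA triangle_r comp_idl.
Qed.

(** The pair of [F c] and the unit at [c] is initial in [under c G], and [g] is the arrow from it to
    the given object; so the latter is initial exactly when [g] is invertible. *)
Lemma is_initial_under_transpose (C D : Category)
  (F : Functor C D) (G : Functor D C) (adj : Adjunction F G)
  (c : C) (y : D) (g : hom (F c) y) :
  is_initial (under c G) (UnderObj y (fmap G g ∘ adj_unit adj c)) <-> is_iso g.
Proof.
split=> [init | [g' [g'g gg']] [z k]].
- have [[h /= hP] _] := init (UnderObj (F c) (adj_unit adj c)).
  have hg : h ∘ g = idm (F c).
    rewrite -(transpose_eq adj (h ∘ g)) (fmap_comp G) -compA hP.
    exact: triangle_l.
  exists h; split=> //.
  have [u uniq] := init (UnderObj y (fmap G g ∘ adj_unit adj c)).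
  have ghP : fmap G (g ∘ h) ∘ (fmap G g ∘ adj_unit adj c) =
             fmap G g ∘ adj_unit adj c by rewrite fmap_comp -compA hP.
  (* [g ∘ h] and the identity are endomorphisms of one initial object. *)
  have e := eq_trans (uniq (exist _ (g ∘ h) ghP))
                   (eq_sym (uniq (under_id (UnderObj _ _)))).
  exact: (f_equal (@proj1_sig _ _) e).
- unshelve eexists.
    (* The transpose of [k], precomposed with the inverse of [g]. *)
    exists (adj_counit adj z ∘ fmap F k ∘ g') => /=.
    by rewrite compA -fmap_comp -compA g'g comp_idr transpose_eqV.
  move=> [h /= hP].
  apply: sig_ext => /=.
  by rewrite -hP compA -fmap_comp transpose_eq -compA gg' comp_idr.
Qed.

(** A preimage under [F] of the counit at [F x] inverts the unit at [x], by the two triangle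
    identities. Conversely, the transpose of [g] followed by the inverse of the unit is a preimage
    of [g]. *)
Lemma full_faithful_unit_iso (C D : Category)
  (F : Functor C D) (G : Functor D C) (adj : Adjunction F G) :
  full F /\ faithful F <-> is_natural_iso (adj_unit adj).
Proof.
split=> [[fullF faithF] x | unit_iso].
- have [h hP] := fullF _ _ (adj_counit adj (F x)).
  exists h; split.
  + by apply: faithF; rewrite fmap_comp hP triangle_l fmap_id.
  + have /= n := naturality (adj_unit adj) h.
    by rewrite -n hP triangle_r.
- split=> [x y g | x y f g e].
  + have [u [_ unit_u]] := unit_iso y.
    exists (u ∘ (fmap G g ∘ adj_unit adj x)).
    rewrite -(comp_idl (fmap F _)) -(triangle_l adj) -compA -fmap_comp.
    by rewrite (compA _ u) unit_u comp_idl transpose_eq.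
  + have /= nf := naturality (adj_unit adj) f.
    have /= ng := naturality (adj_unit adj) g.
    by apply: (is_iso_mono (unit_iso y)); rewrite -nf -ng e.
Qed.

Lemma full_faithful_counit_iso (C D : Category)
  (F : Functor C D) (G : Functor D C) (adj : Adjunction F G) :
  full G /\ faithful G <-> is_natural_iso (adj_counit adj).
Proof.
have [ff iso] := full_faithful_unit_iso (op_adjunction adj).
split=> [[fullG faithG] y | counit_iso].
- by apply/is_iso_op; apply: ff; split=> x z; [apply: fullG | apply: faithG].
- have [|fullG faithG] := iso; first by move=> y; apply/is_iso_op/counit_iso.
  by split=> x y; [apply: (fullG y x) | apply: (faithG y x)].
Qed.

(** Naturality of the unit makes [f] isomorphic to [fmap G (fmap F f)]. *)
Lemma unit_iso_reflects_iso (C D : Category)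
  (F : Functor C D) (G : Functor D C) (adj : Adjunction F G)
  (x y : C) (f : hom x y) :
  is_natural_iso (adj_unit adj) -> is_iso (fmap F f) -> is_iso f.
Proof.
move=> unit_iso Ff_iso; apply: (is_iso_cancell (unit_iso y)).
have /= <- := naturality (adj_unit adj) f.
by apply: is_iso_comp; [apply: is_iso_fmap | apply: unit_iso].
Qed.

Lemma fmap_unit_iso (C D : Category)
  (F : Functor C D) (G : Functor D C) (adj : Adjunction F G) (x : C) :
  is_natural_iso (adj_counit adj) -> is_iso (fmap F (adj_unit adj x)).
Proof.
move=> counit_iso; apply: (is_iso_cancell (counit_iso (F x))).
by rewrite triangle_l; apply: is_iso_idm.
Qed.

(** The composite counit at [y] is the counit of [adjNJ] after [N] of the counit of [adjIM] at
    [J y]; the second factor cancels. *)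
Lemma counit_iso_of_comp (A B D : Category)
  (I : Functor A B) (M : Functor B A) (N : Functor B D) (J : Functor D B)
  (adjNJ : Adjunction N J) (adjIM : Adjunction I M) :
  is_natural_iso (adj_counit (comp_adjunction adjNJ adjIM)) ->
  (forall x : B, is_iso (fmap N (adj_counit adjIM x))) ->
  is_natural_iso (adj_counit adjNJ).
Proof.
move=> counit_iso Npsi_iso y; have /= := counit_iso y.
exact: is_iso_cancelr (Npsi_iso _).
Qed.

Lemma unit_iso_of_comp (A B D : Category)
  (I : Functor A B) (M : Functor B A) (N : Functor B D) (J : Functor D B)
  (adjNJ : Adjunction N J) (adjIM : Adjunction I M) :
  is_natural_iso (adj_unit (comp_adjunction adjNJ adjIM)) ->
  (forall x : B, is_iso (fmap M (adj_unit adjNJ x))) ->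
  is_natural_iso (adj_unit adjIM).
Proof.
move=> unit_iso Mtheta_iso x; have /= := unit_iso x.
exact: is_iso_cancell (Mtheta_iso _).
Qed.

Lemma fmap_unit_iso_of_fmap_counit_iso (A B D : Category)
  (I : Functor A B) (M : Functor B A) (N : Functor B D) (J : Functor D B)
  (adjNJ : Adjunction N J) (adjIM : Adjunction I M) :
  is_adjoint_equivalence (comp_adjunction adjNJ adjIM) ->
  (forall x : B, is_iso (fmap N (adj_counit adjIM x))) ->
  forall x : B, is_iso (fmap M (adj_unit adjNJ x)).
Proof.
move=> [unit_iso counit_iso] Npsi_iso x.
apply: (unit_iso_reflects_iso unit_iso) => /=.
(* With ψ at [J (N x)] composed on the left, naturality of ψ turns N I M θ into N θ after N ψ, both
   at [x]. *)
apply: (is_iso_cancell (Npsi_iso _)).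
have /= n := naturality (adj_counit adjIM) (adj_unit adjNJ x).
rewrite -fmap_comp -n fmap_comp; apply: is_iso_comp (Npsi_iso x).
by apply: fmap_unit_iso; apply: counit_iso_of_comp counit_iso Npsi_iso.
Qed.

Lemma fmap_counit_iso_of_fmap_unit_iso (A B D : Category)
  (I : Functor A B) (M : Functor B A) (N : Functor B D) (J : Functor D B)
  (adjNJ : Adjunction N J) (adjIM : Adjunction I M) :
  is_adjoint_equivalence (comp_adjunction adjNJ adjIM) ->
  (forall x : B, is_iso (fmap M (adj_unit adjNJ x))) ->
  forall x : B, is_iso (fmap N (adj_counit adjIM x)).
Proof.
move=> [unit_iso counit_iso] Mtheta_iso x; apply/is_iso_op.
(* In the opposite categories the two adjunctions exchange roles, and θ becomes the counit whose
   image is assumed invertible. *)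
apply: (fmap_unit_iso_of_fmap_counit_iso
  (adjNJ := op_adjunction adjIM) (adjIM := op_adjunction adjNJ)).
- by split=> y; apply/is_iso_op; [apply: counit_iso | apply: unit_iso].
- by move=> y; apply/is_iso_op/Mtheta_iso.
Qed.

Theorem theorem3p4
  (C CM CN : Category)
  (I : Functor CM C) (M : Functor C CM)
  (N : Functor C CN) (J : Functor CN C)
  (adjNJ : Adjunction N J) (adjIM : Adjunction I M) :
  let theta := adj_unit adjNJ in
  let psi := adj_counit adjIM in
  let adjNIMJ : Adjunction (compF N I) (compF M J) :=
    comp_adjunction adjNJ adjIM in
  let cond_i :=
    forall x : C,
      is_initial (under (I (M x)) J) (UnderObj (N x) (theta x ∘ psi x)) in
  let cond_ii := forall x : C, is_iso (fmap N (psi x)) in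
  let cond_iii :=
    forall x : C,
      is_final (over I (J (N x))) (OverObj (M x) (theta x ∘ psi x)) in
  let cond_iv := forall x : C, is_iso (fmap M (theta x)) in
  (cond_i <-> cond_ii) /\
  (cond_iii <-> cond_iv) /\
  (cond_i /\ cond_ii /\ cond_iii /\ cond_iv ->
   full I /\ faithful I -> full J /\ faithful J ->
   is_adjoint_equivalence adjNIMJ) /\
  (is_adjoint_equivalence adjNIMJ ->
   ((cond_i <-> cond_ii) /\ (cond_ii <-> cond_iii) /\
    (cond_iii <-> cond_iv)) /\
   (cond_i \/ cond_ii \/ cond_iii \/ cond_iv ->
    (full I /\ faithful I) /\ (full J /\ faithful J))).
Proof.
move=> theta psi adjNIMJ cond_i cond_ii cond_iii cond_iv.
have i_ii : cond_i <-> cond_ii.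
  have pw x := is_initial_under_transpose adjNJ (fmap N (psi x)).
  have /= n x := naturality theta (psi x).
  (* Naturality of θ rewrites [theta x ∘ psi x] as the transpose of [fmap N (psi x)]. *)
  by split=> H x; move: (H x); rewrite -n; apply (pw x).
have iii_iv : cond_iii <-> cond_iv.
  (* Dually, naturality of ψ exhibits [theta x ∘ psi x] as the transpose of [fmap M (theta x)], here
     read as an arrow of [op CM] from [M (J (N x))] to [M x]. *)
  have pw x := is_initial_under_transpose (op_adjunction adjIM)
                 (fmap M (theta x) : @hom (op CM) _ _).
  have /= n x := naturality psi (theta x).
  split=> H x; move: (H x).
    by rewrite n => /is_final_over_op/(pw x)/is_iso_op.
  by rewrite n => /is_iso_op/(pw x)/is_final_over_op.
have ii_iv : is_adjoint_equivalence adjNIMJ -> (cond_ii <-> cond_iv).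
  move=> equiv; split; first exact: fmap_unit_iso_of_fmap_counit_iso.
  exact: fmap_counit_iso_of_fmap_unit_iso.
split=> //; split=> //; split.
- move=> [_ [ii [_ iv]]] ffI ffJ; split=> x /=.
  (* Of the two factors of the composite unit, one is invertible by (iv) and the other because [I]
     is full and faithful; the counit uses (ii) and [J] likewise. *)
  + apply: (is_iso_comp (iv (I x))).
    exact: (proj1 (full_faithful_unit_iso adjIM) ffI x).
  + apply: is_iso_comp (ii (J x)).
    exact: (proj1 (full_faithful_counit_iso adjNJ) ffJ x).
- move=> equiv; have {}ii_iv := ii_iv equiv.
  split; first by tauto.
  (* Any one condition now yields both (ii) and (iv): the latter serves [I], the former [J]. *)
  move=> some; have [ii iv] : cond_ii /\ cond_iv by tauto.
  have [unit_iso counit_iso] := equiv; split.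
  + apply/(full_faithful_unit_iso adjIM).
    exact: unit_iso_of_comp unit_iso iv.
  + apply/(full_faithful_counit_iso adjNJ).
    exact: counit_iso_of_comp counit_iso ii.
Qed.
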